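(* Let $(X_k)_{k\in\mathbb{Z}}$ be Banach spaces, let $T_k\in L(X_k,X_{k-1})$ for $k\in\mathbb{Z}$ with $\sup_{k\in\mathbb{Z}}\|T_k\|<\infty$, and let $B_{(T_k)}$ be the associated shift operator on $\ell^p((X_k)_k,\mathbb{Z})$ with $1\le p<\infty$ or on $c_0((X_k)_k,\mathbb{Z})$. The following assertions are equivalent: (1) $B_{(T_k)}$ is mixing; (2) for every $j\in\mathbb{Z}$ and all non-empty open subsets $U_j,V_j$ of $X_j$, there exists $n_0$ such that for every $n\ge n_0$, $$T_{j-n,j}U_j\cap B_{j-n}(0,1)\neq\emptyset\quad\text{and}\quad T_{j,j+n}B_{j+n}(0,1)\cap V_j\neq\emptyset .$$
   Context: Banach spaces are over $\mathbb{K}=\mathbb{R}$ or $\mathbb{C}$, and $L(X,Z)$ denotes the bounded linear operators from $X$ to $Z$. $\ell^p((X_k)_k,\mathbb{Z})=\{(x_k)_{k}\in\prod_{k\in\mathbb{Z}} X_k:\sum_k\|x_k\|^p<\infty\}$ with norm $(\sum_k\|x_k\|^p)^{1/p}$, and $c_0((X_k)_k,\mathbb{Z})=\{(x_k)_k\in\prod_{k\in\mathbb{Z}} X_k:\lim_{|k|\to\infty}\|x_k\|=0\}$ with norm $\sup_k\|x_k\|$. The shift is $B_{(T_k)}(x_k)_{k\in\mathbb{Z}}=(T_{k+1}x_{k+1})_{k\in\mathbb{Z}}$; it is a bounded operator because $\sup_k\|T_k\|<\infty$. For $k<n$, $T_{k,n}=T_{k+1}\circ\cdots\circ T_n\in L(X_n,X_k)$,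 and $T_{n,n}=I$. $B_k(x,r)$ is the open ball of $X_k$ centered at $x$ with radius $r$. An operator $S$ on a Banach space $Y$ is mixing if for all non-empty open sets $U,V\subset Y$ the set $\{n\ge 0:S^nU\cap V\neq\emptyset\}$ is cofinite. *)

(* Defs.v *)
From HB Require Import structures.
From mathcomp Require Import all_boot all_order all_algebra.
From mathcomp Require Import all_classical all_reals all_analysis.
From mathcomp Require Import complex.
From mathcomp Require Import ring zify.

Set Implicit Arguments.
Unset Strict Implicit.
Unset Printing Implicit Defensive.

Import Order.TTheory GRing.Theory Num.Theory.
Import numFieldNormedType.Exports.

Local Open Scope classical_set_scope.
Local Open Scope ring_scope.

Inductive scalars := RealScalars | ComplexScalars.

Definition scalar_field (R : realType) (s : scalars) : numFieldType :=
  match s with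
  | RealScalars => R
  | ComplexScalars => R[i]%C
  end.

Definition real_part (R : realType) (s : scalars) : scalar_field R s -> R :=
  match s with
  | RealScalars => fun x : R => x
  | ComplexScalars => fun z : R[i]%C => complex.Re z
  end.

Definition of_real (R : realType) (s : scalars) : R -> scalar_field R s :=
  match s with
  | RealScalars => fun x : R => x
  | ComplexScalars => fun x : R => (x%:C)%C
  end.
Arguments of_real {R s}.

(* In a normed module over R[i], the norm `|x| has values in R[i]. *)
Definition rnorm (R : realType) (s : scalars)
  (V : normedModType (scalar_field R s)) (x : V) : R := real_part `|x|.

Section scalar_theory.
Variables (R : realType) (s : scalars).
Local Notation K := (scalar_field R s).
Implicit Types (V : normedModType K).

Lemma of_realK (a : R) : real_part (of_real a : K) = a.
Proof. by case: s. Qed.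

Lemma real_partK (z : K) : 0 <= z -> of_real (real_part z) = z.
Proof. by case: s z => //= z z0; exact/RRe_real/ger0_real. Qed.

Lemma le_of_real (a b : R) : ((of_real a : K) <= of_real b) = (a <= b).
Proof. by case: s => //=; exact: lecR. Qed.

Lemma of_realD (a b : R) : (of_real (a + b) : K) = of_real a + of_real b.
Proof. by case: s => //=; exact: rmorphD. Qed.

Lemma of_realM (a b : R) : (of_real (a * b) : K) = of_real a * of_real b.
Proof. by case: s => //=; exact: rmorphM. Qed.

Lemma of_real0 : (of_real 0 : K) = 0.
Proof. by case: s. Qed.

Lemma of_real_rnorm V (x : V) : of_real (rnorm x) = `|x|.
Proof. exact: real_partK. Qed.

Lemma rnorm_ge0 V (x : V) : 0 <= rnorm x.
Proof. by rewrite -le_of_real of_real_rnorm of_real0. Qed.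

Lemma rnormD V (x y : V) : rnorm (x + y) <= rnorm x + rnorm y.
Proof. by rewrite -le_of_real of_realD !of_real_rnorm ler_normD. Qed.

Lemma of_real_inj : injective (of_real : R -> K).
Proof. by move=> a b ab; rewrite -(of_realK a) ab of_realK. Qed.

Lemma rnormZ V (a : K) (x : V) : rnorm (a *: x) = real_part `|a| * rnorm x.
Proof.
by apply: of_real_inj; rewrite of_realM real_partK// !of_real_rnorm normrZ.
Qed.

Lemma rnorm_eq0 V (x : V) : rnorm x = 0 -> x = 0.
Proof.
by move=> x0; apply/normr0_eq0; rewrite -of_real_rnorm x0 of_real0.
Qed.

Lemma rnorm0 V : rnorm (0 : V) = 0.
Proof. by apply: of_real_inj; rewrite of_real_rnorm normr0 of_real0. Qed.

Lemma real_part_ge0 (a : K) : 0 <= real_part `|a|.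
Proof. by rewrite -le_of_real real_partK// of_real0. Qed.

Lemma real_part_eq0 (a : K) : real_part `|a| = 0 -> a = 0.
Proof.
by move=> a0; apply/normr0_eq0; rewrite -[`|a|]real_partK// a0 of_real0.
Qed.

Lemma norm_of_real (a : R) : 0 <= a -> real_part `|of_real a : K| = a.
Proof.
by move=> a0; rewrite ger0_norm ?of_realK// -of_real0 le_of_real.
Qed.

Definition opnorm (V W : normedModType K) (f : V -> W) : \bar R :=
  ereal_sup [set (rnorm (f x))%:E | x in [set x : V | rnorm x <= 1]].

Lemma opnorm_bound (V W : normedModType K) (f : {linear V -> W}) (C : R) :
  (opnorm f <= C%:E)%E -> forall x, rnorm (f x) <= C * rnorm x.
Proof.
move=> fC x; have [x0|x0] := eqVneq (rnorm x) 0.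
  by rewrite x0 (rnorm_eq0 x0) linear0 rnorm0 mulr0.
have xp : 0 < rnorm x by rewrite lt_neqAle eq_sym x0 rnorm_ge0.
pose a : K := of_real (rnorm x)^-1.
have na : real_part `|a| = (rnorm x)^-1 by rewrite norm_of_real ?invr_ge0 ?ltW.
have : rnorm (f (a *: x)) <= C.
  rewrite -lee_fin; apply: le_trans fC; apply: ereal_sup_ubound.
  by exists (a *: x) => //=; rewrite rnormZ na mulVf.
by rewrite linearZ/= rnormZ na mulrC ler_pdivrMr.
Qed.

End scalar_theory.

(* A subspace of the sequences (x_k)_{k in Z}, x_k in X_k, with a norm on it;
   [seq_carrier] equips the subspace with its normed module structure. *)
Record seq_space (R : realType) (s : scalars)
    (X : int -> normedModType (scalar_field R s)) := SeqSpace {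
  seq_dom : set (forall k, X k) ;
  seq_norm : (forall k, X k) -> R ;
  seq_dom0 : seq_dom (fun=> 0) ;
  seq_domD : forall x y, seq_dom x -> seq_dom y -> seq_dom (fun k => x k + y k) ;
  seq_domZ : forall (a : scalar_field R s) x, seq_dom x ->
    seq_dom (fun k => a *: x k) ;
  seq_normD : forall x y, seq_dom x -> seq_dom y ->
    seq_norm (fun k => x k + y k) <= seq_norm x + seq_norm y ;
  seq_normZ : forall (a : scalar_field R s) x, seq_dom x ->
    seq_norm (fun k => a *: x k) = real_part `|a| * seq_norm x ;
  seq_norm_eq0 : forall x, seq_dom x -> seq_norm x = 0 -> forall k, x k = 0
}.

Record seq_carrier (R : realType) (s : scalars)
    (X : int -> normedModType (scalar_field R s)) (E : seq_space X) := SeqElt {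
  seq_val :> forall k, X k ;
  seq_valP : seq_dom E seq_val
}.

Section seq_carrier_theory.
Variables (R : realType) (s : scalars).
Local Notation K := (scalar_field R s).
Variables (X : int -> normedModType K) (E : seq_space X).
Local Notation Y := (seq_carrier E).

Lemma seq_eqP (x y : Y) : (forall k, x k = y k) -> x = y.
Proof.
case: x y => [x Px] [y Py] /= xy.
have {}xy : x = y by exact: functional_extensionality_dep.
by subst y; rewrite (Prop_irrelevance Px Py).
Qed.

HB.instance Definition _ := gen_eqMixin Y.
HB.instance Definition _ := gen_choiceMixin Y.

Definition seq_zero : Y := SeqElt (seq_dom0 E).
Definition seq_add (x y : Y) : Y := SeqElt (seq_domD (seq_valP x) (seq_valP y)).
Definition seq_scale (a : K) (x : Y) : Y := SeqElt (seq_domZ a (seq_valP x)).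

Let addA : associative seq_add.
Proof. by move=> x y z; apply: seq_eqP => k /=; rewrite addrA. Qed.
Let addC : commutative seq_add.
Proof. by move=> x y; apply: seq_eqP => k /=; rewrite addrC. Qed.
Let add0 : left_id seq_zero seq_add.
Proof. by move=> x; apply: seq_eqP => k /=; rewrite add0r. Qed.
Let addN : left_inverse seq_zero (seq_scale (-1)) seq_add.
Proof. by move=> x; apply: seq_eqP => k /=; rewrite scaleN1r addNr. Qed.

HB.instance Definition _ := GRing.isZmodule.Build Y addA addC add0 addN.

Let scaleA a b (x : Y) : seq_scale a (seq_scale b x) = seq_scale (a * b) x.
Proof. by apply: seq_eqP => k /=; rewrite scalerA. Qed.
Let scale1 : left_id 1 seq_scale.
Proof. by move=> x; apply: seq_eqP => k /=; rewrite scale1r. Qed.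
Let scaleDr : right_distributive seq_scale +%R.
Proof. by move=> a x y; apply: seq_eqP => k /=; rewrite scalerDr. Qed.
Let scaleDl (x : Y) : {morph seq_scale^~ x : a b / a + b}.
Proof. by move=> a b; apply: seq_eqP => k /=; rewrite scalerDl. Qed.

HB.instance Definition _ :=
  GRing.Zmodule_isLmodule.Build K Y scaleA scale1 scaleDr scaleDl.

Definition seq_knorm (x : Y) : K := of_real (seq_norm E x).

Let knormD (x y : Y) : seq_knorm (x + y) <= seq_knorm x + seq_knorm y.
Proof.
by rewrite /seq_knorm -of_realD le_of_real; apply: seq_normD; exact: seq_valP.
Qed.
Let knormZ (a : K) (x : Y) : seq_knorm (a *: x) = `|a| * seq_knorm x.
Proof.
rewrite /seq_knorm -[`|a|]real_partK// -of_realM; congr of_real.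
by apply: seq_normZ; exact: seq_valP.
Qed.
Let knorm_eq0 (x : Y) : seq_knorm x = 0 -> x = 0.
Proof.
rewrite /seq_knorm -[RHS](@of_real0 R s) => /of_real_inj x0; apply: seq_eqP => k.
by apply: (seq_norm_eq0 _ x0); exact: seq_valP.
Qed.

HB.instance Definition _ := Lmodule_isNormed.Build K Y knormD knormZ knorm_eq0.

End seq_carrier_theory.

Section lp_c0.
Variables (R : realType) (s : scalars).
Local Notation K := (scalar_field R s).
Variable X : int -> normedModType K.
Implicit Types x y : forall k, X k.

Definition lp_sum (p : R) x : \bar R :=
  \esum_(k in [set: int]) ((rnorm (x k)) `^ p)%:E.

Definition lp_dom (p : R) : set (forall k, X k) :=
  [set x | (lp_sum p x < +oo)%E].

Definition lp_norm (p : R) x : R := (fine (lp_sum p x)) `^ p^-1.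

Definition c0_dom : set (forall k, X k) :=
  [set x | forall e : R, 0 < e ->
    exists N : nat, forall k : int, (N <= `|k|)%N -> rnorm (x k) < e].

Definition c0_norm x : R := sup (range (fun k => rnorm (x k))).

Section lp.
Variables (p : R) (p1 : 1 <= p).

Let p_gt0 : 0 < p. Proof. exact: lt_le_trans p1. Qed.
Let p_neq0 : p != 0. Proof. by rewrite gt_eqF. Qed.

Lemma lp_sum_ge0 x : (0 <= lp_sum p x)%E.
Proof. by apply: esum_ge0 => k _; rewrite lee_fin powR_ge0. Qed.

Lemma lp_sum_fin x : lp_dom p x -> lp_sum p x \is a fin_num.
Proof. by move=> xp; rewrite ge0_fin_numE// lp_sum_ge0. Qed.

Lemma lp_norm_ge0 x : 0 <= lp_norm p x. Proof. exact: powR_ge0. Qed.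

Lemma lp_sumE x : lp_dom p x -> lp_sum p x = ((lp_norm p x) `^ p)%:E.
Proof.
move=> xp; rewrite /lp_norm -powRrM mulVf// powRr1 ?fine_ge0 ?lp_sum_ge0//.
by rewrite fineK// lp_sum_fin.
Qed.

Lemma lp_sum_eq0 x : lp_sum p x = 0%E -> forall k, x k = 0.
Proof.
move=> x0 k; apply: rnorm_eq0; apply: (@powR_eq0_eq0 _ _ p).
apply/eqP; rewrite eq_le powR_ge0 andbT -lee_fin (_ : 0%:E = lp_sum p x)//.
apply: esum_ge; exists [set k]; first by split; [exact: finite_set1|].
by rewrite fsbig_set1.
Qed.

Lemma esum_scale (a : R) (f : int -> R) : 0 <= a -> (forall k, 0 <= f k) ->
  (\esum_(k in [set: int]) (a * f k)%:E <=
   a%:E * \esum_(k in [set: int]) (f k)%:E)%E.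
Proof.
move=> a0 f0; apply: ge_ereal_sup => _ [F [finF _] <-].
under eq_fsbigr do rewrite EFinM.
rewrite -ge0_mule_fsumr; last by move=> k; rewrite lee_fin.
by apply: lee_wpmul2l; rewrite ?lee_fin//; apply: esum_ge; exists F.
Qed.

Lemma lp_sumZ_le (a : K) x :
  (lp_sum p (fun k => a *: x k) <= ((real_part `|a|) `^ p)%:E * lp_sum p x)%E.
Proof.
rewrite /lp_sum; under eq_esum do rewrite rnormZ powRM ?rnorm_ge0 ?real_part_ge0//.
by apply: esum_scale => [|k]; exact: powR_ge0.
Qed.

Lemma lp_domZ (a : K) x : lp_dom p x -> lp_dom p (fun k => a *: x k).
Proof.
move=> xp; rewrite /lp_dom/=; apply: le_lt_trans (lp_sumZ_le a x) _.
by rewrite lp_sumE// -EFinM ltry.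
Qed.

Lemma powR_le2 (a b : R) : 0 <= a -> 0 <= b -> a `^ p <= b `^ p -> a <= b.
Proof.
move=> a0 b0; rewrite !leNgt; apply: contra => ba.
by apply: gt0_ltr_powR; rewrite ?nnegrE.
Qed.

Lemma lp_normZ_le (a : K) x : lp_dom p x ->
  lp_norm p (fun k => a *: x k) <= real_part `|a| * lp_norm p x.
Proof.
move=> xp; apply: powR_le2; rewrite ?mulr_ge0 ?real_part_ge0 ?lp_norm_ge0//.
have := lp_sumZ_le a x; rewrite !lp_sumE//; last exact: lp_domZ.
by rewrite -EFinM lee_fin powRM// ?real_part_ge0 ?lp_norm_ge0.
Qed.

Lemma lp_normZ (a : K) x : lp_dom p x ->
  lp_norm p (fun k => a *: x k) = real_part `|a| * lp_norm p x.
Proof.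
move=> xp; apply/eqP; rewrite eq_le lp_normZ_le//=.
have [->|a0] := eqVneq a 0.
  by rewrite normr0 -(@of_real0 R s) of_realK mul0r lp_norm_ge0.
have an0 : real_part `|a| != 0 by apply: contra_neq a0 => /real_part_eq0.
have ap : 0 < real_part `|a| by rewrite lt_neqAle eq_sym an0 real_part_ge0.
have := lp_normZ_le a^-1 (lp_domZ a xp).
under [X in lp_norm p X]functional_extensionality_dep do
  rewrite scalerA mulVf// scale1r.
suff -> : real_part `|a^-1| = (real_part `|a|)^-1.
  by rewrite -ler_pdivlMl.
apply: (mulIf an0); rewrite mulVf//; apply: (@of_real_inj R s).
by rewrite of_realM !real_partK// -normrM mulVf// normr1; case: s.
Qed.

Lemma lp_norm_eq0 x : lp_dom p x -> lp_norm p x = 0 -> forall k, x k = 0.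
Proof. by move=> xp x0; apply: lp_sum_eq0; rewrite lp_sumE// x0 powR0. Qed.

Lemma lp_dom0 : lp_dom p (fun=> 0).
Proof.
rewrite /lp_dom/= /lp_sum esum1 ?ltry// => k _.
by rewrite rnorm0 powR0.
Qed.

Lemma powR_split (a b c u v : R) :
  0 < a -> 0 < b -> 0 < c -> a + b = c -> 0 <= u -> 0 <= v ->
  (u + v) `^ p <=
  c `^ p * (a / c) / a `^ p * u `^ p + c `^ p * (b / c) / b `^ p * v `^ p.
Proof.
move=> a0 b0 c0 abc u0 v0; pose t := a / c.
have t0 : 0 <= t by rewrite divr_ge0 ?ltW.
have t1 : t <= 1 by rewrite ler_pdivrMr// mul1r -abc lerDl ltW.
have tE : b / c = 1 - t.
  by rewrite /t -abc; field; rewrite abc gt_eqF.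
have ua : 0 <= u / a by rewrite divr_ge0// ltW.
have vb : 0 <= v / b by rewrite divr_ge0// ltW.
have t1' : 0 <= 1 - t by rewrite subr_ge0.
have Eu : u `^ p = a `^ p * (u / a) `^ p.
  by rewrite -powRM// ?ltW// mulrCA divff ?gt_eqF// mulr1.
have Ev : v `^ p = b `^ p * (v / b) `^ p.
  by rewrite -powRM// ?ltW// mulrCA divff ?gt_eqF// mulr1.
have ap : a `^ p != 0 by rewrite gt_eqF// powR_gt0.
have bp : b `^ p != 0 by rewrite gt_eqF// powR_gt0.
have -> : u + v = c * (t * (u / a) + (1 - t) * (v / b)).
  by rewrite -tE /t; field; rewrite !gt_eqF.
have tuv : 0 <= t * (u / a) + (1 - t) * (v / b).
  by apply: addr_ge0; apply: mulr_ge0.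
rewrite powRM ?(ltW c0)//.
rewrite Eu Ev tE -/t; set cp := c `^ p.
have split_eq A B U V : A != 0 -> B != 0 ->
  cp * t / A * (A * U) + cp * (1 - t) / B * (B * V) = cp * (t * U + (1 - t) * V).
  by move=> A0 B0; field; rewrite A0 B0.
rewrite split_eq//; apply: ler_wpM2l; first exact: powR_ge0.
have := @convex_powR R p p1 (Itv01 t0 t1) (u / a) (v / b).
by rewrite !inE/= !in_itv/= !andbT => /(_ ua vb); rewrite !convRE.
Qed.

Lemma lp_sumD_le x y : lp_dom p x -> lp_dom p y ->
  (lp_sum p (fun k => (x k + y k)%R) <=
   ((lp_norm p x + lp_norm p y)%R `^ p)%:E)%E.
Proof.
move=> xp yp.
have xE := lp_sumE xp; have yE := lp_sumE yp.
have := lp_norm_ge0 x; have := lp_norm_ge0 y.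
have := lp_norm_eq0 xp; have := lp_norm_eq0 yp.
move: (lp_norm p x) (lp_norm p y) xE yE => a b xE yE y00 x00 b_ge0 a_ge0.
have [a0|a0] := eqVneq a 0.
  rewrite a0 add0r -yE; apply: le_esum => k _.
  by rewrite x00// add0r.
have [b0|b0] := eqVneq b 0.
  rewrite b0 addr0 -xE; apply: le_esum => k _.
  by rewrite y00// addr0.
have ap : 0 < a by rewrite lt_neqAle eq_sym a0.
have bp : 0 < b by rewrite lt_neqAle eq_sym b0.
have [c abc] : exists c, a + b = c by exists (a + b).
have cp : 0 < c by rewrite -abc addr_gt0.
rewrite abc.
pose al := c `^ p * (a / c) / a `^ p.
pose be := c `^ p * (b / c) / b `^ p.
have al0 : 0 <= al.
  by rewrite /al !mulr_ge0 ?invr_ge0 ?powR_ge0// ltW.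
have be0 : 0 <= be.
  by rewrite /be !mulr_ge0 ?invr_ge0 ?powR_ge0// ltW.
apply: (@le_trans _ _ (\esum_(k in [set: int])
    ((al * rnorm (x k) `^ p)%:E + (be * rnorm (y k) `^ p)%:E)%E)).
  apply: le_esum => k _; rewrite -EFinD lee_fin.
  apply: le_trans (powR_split ap bp cp abc (rnorm_ge0 _) (rnorm_ge0 _)).
  apply: ge0_ler_powR; first exact: ltW.
  - by rewrite nnegrE rnorm_ge0.
  - by rewrite nnegrE addr_ge0// rnorm_ge0.
  - exact: rnormD.
rewrite esumD; last 2 first.
- by move=> k _; rewrite lee_fin mulr_ge0 ?powR_ge0.
- by move=> k _; rewrite lee_fin mulr_ge0 ?powR_ge0.
have -> : (c `^ p)%:E = (al%:E * (a `^ p)%:E + be%:E * (b `^ p)%:E)%E.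
  rewrite -!EFinM -EFinD; congr EFin.
  rewrite /al /be !divfK ?gt_eqF ?powR_gt0//.
  by rewrite -mulrDr -mulrDl abc divff ?mulr1// gt_eqF.
rewrite -xE -yE; apply: leeD; apply: esum_scale => // k; exact: powR_ge0.
Qed.

Lemma lp_domD x y : lp_dom p x -> lp_dom p y -> lp_dom p (fun k => x k + y k).
Proof.
move=> xp yp; rewrite /lp_dom/=.
by apply: le_lt_trans (lp_sumD_le xp yp) _; rewrite ltry.
Qed.

Lemma lp_normD x y : lp_dom p x -> lp_dom p y ->
  lp_norm p (fun k => x k + y k) <= lp_norm p x + lp_norm p y.
Proof.
move=> xp yp; apply: powR_le2; rewrite ?addr_ge0 ?lp_norm_ge0//.
rewrite -lee_fin -lp_sumE; first exact: lp_sumD_le.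
exact: lp_domD.
Qed.

Definition lp_space : seq_space X :=
  SeqSpace lp_dom0 lp_domD lp_domZ lp_normD lp_normZ lp_norm_eq0.

End lp.

Lemma c0_has_sup x : c0_dom x -> has_sup (range (fun k => rnorm (x k))).
Proof.
move=> /(_ 1 ltr01) [N xN]; split; first by exists (rnorm (x 0)), 0.
exists (1 + \sum_(i < N) (rnorm (x i%:Z) + rnorm (x (- i%:Z)))) => _ [k _ <-].
have ge0 (i : 'I_N) : 0 <= rnorm (x i%:Z) + rnorm (x (- i%:Z)).
  by rewrite addr_ge0 ?rnorm_ge0.
have [Nk|kN] := leqP N `|k|%N.
  by apply: (le_trans (ltW (xN k Nk))); rewrite lerDl sumr_ge0.
rewrite (bigD1 (Ordinal kN))//= addrCA -[leLHS]addr0; apply: lerD; last first.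
  by rewrite addr_ge0// sumr_ge0.
have [k0|k0] := leP 0 k.
  by rewrite gez0_abs// lerDl rnorm_ge0.
by rewrite [in leRHS]ltz0_abs// opprK lerDr rnorm_ge0.
Qed.

Lemma c0_norm_ub x k : c0_dom x -> rnorm (x k) <= c0_norm x.
Proof.
by move=> /c0_has_sup [_ xu]; apply: (ub_le_sup xu); exists k.
Qed.

Lemma c0_norm_le x C : (forall k, rnorm (x k) <= C) -> c0_norm x <= C.
Proof.
move=> xC; apply: ge_sup; first by exists (rnorm (x 0)), 0.
by move=> _ [k _ <-].
Qed.

Lemma c0_dom0 : c0_dom (fun=> 0).
Proof. by move=> e e0; exists 0%N => k _; rewrite rnorm0. Qed.

Lemma c0_domD x y : c0_dom x -> c0_dom y -> c0_dom (fun k => x k + y k).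
Proof.
move=> x0 y0 e e0; have e2 : 0 < e / 2 by rewrite divr_gt0.
have [N xN] := x0 _ e2; have [M yM] := y0 _ e2.
exists (maxn N M) => k; rewrite geq_max => /andP[Nk Mk].
apply: le_lt_trans (rnormD _ _) _; rewrite [e]splitr.
by apply: ltrD; [exact: xN|exact: yM].
Qed.

Lemma c0_domZ (a : K) x : c0_dom x -> c0_dom (fun k => a *: x k).
Proof.
move=> x0 e e0; have d0 : 0 < real_part `|a| + 1.
  by rewrite ltr_wpDl ?real_part_ge0.
have [N xN] := x0 _ (divr_gt0 e0 d0); exists N => k /xN.
rewrite ltr_pdivlMr// => h; rewrite rnormZ mulrC; apply: le_lt_trans h.
by apply: ler_wpM2l; rewrite ?rnorm_ge0 ?lerDl.
Qed.

Lemma c0_normD x y : c0_dom x -> c0_dom y ->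
  c0_norm (fun k => x k + y k) <= c0_norm x + c0_norm y.
Proof.
move=> x0 y0; apply: c0_norm_le => k; apply: le_trans (rnormD _ _) _.
by apply: lerD; exact: c0_norm_ub.
Qed.

Lemma c0_norm_ge0 x : c0_dom x -> 0 <= c0_norm x.
Proof. by move=> x0; apply: le_trans (c0_norm_ub 0 x0); exact: rnorm_ge0. Qed.

Lemma c0_normZ (a : K) x : c0_dom x ->
  c0_norm (fun k => a *: x k) = real_part `|a| * c0_norm x.
Proof.
move=> x0; apply/eqP; rewrite eq_le; apply/andP; split.
  apply: c0_norm_le => k; rewrite rnormZ.
  by apply: ler_wpM2l; [exact: real_part_ge0|exact: c0_norm_ub].
have [a0|a0] := eqVneq (real_part `|a|) 0.
  by rewrite a0 mul0r; exact/c0_norm_ge0/c0_domZ.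
have ap : 0 < real_part `|a| by rewrite lt_neqAle eq_sym a0 real_part_ge0.
rewrite -ler_pdivlMl//; apply: c0_norm_le => k.
by rewrite ler_pdivlMl// -rnormZ; exact: (c0_norm_ub _ (c0_domZ a x0)).
Qed.

Lemma c0_norm_eq0 x : c0_dom x -> c0_norm x = 0 -> forall k, x k = 0.
Proof.
move=> xc x0 k; apply: rnorm_eq0; apply/eqP.
by rewrite eq_le rnorm_ge0 andbT -x0 c0_norm_ub.
Qed.

Definition c0_space : seq_space X :=
  SeqSpace c0_dom0 c0_domD c0_domZ c0_normD c0_normZ c0_norm_eq0.

End lp_c0.

Arguments lp_space {R s} X {p} p1.
Arguments c0_space {R s} X.

Definition transport (X : int -> Type) (k l : int) (e : k = l) (x : X k) : X l :=
  eq_rect k X x l e.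
Arguments transport X {k l} e x.

Section shift.
Variables (R : realType) (s : scalars).
Local Notation K := (scalar_field R s).
Variable X : int -> normedModType K.
Variable T : forall k, {linear X k -> X (k - 1)}.

Lemma rnorm_transport k l (e : k = l) (x : X k) :
  rnorm (transport X e x) = rnorm x.
Proof. by case: l / e. Qed.

Definition sup_opnorm : \bar R := ereal_sup (range (fun k => opnorm (T k))).

Definition shift_seq (x : forall k, X k) (k : int) : X k :=
  transport X (addrK 1 k) (T (k + 1) (x (k + 1))).

Hypothesis T_bounded : (sup_opnorm < +oo)%E.

Lemma shift_bound : exists2 C : R, 0 <= C &
  forall x k, rnorm (shift_seq x k) <= C * rnorm (x (k + 1)).
Proof.
have Tk k : (opnorm (T k) <= sup_opnorm)%E by apply: ereal_sup_ubound; exists k.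
have T0 : (0 <= sup_opnorm)%E.
  apply: le_trans (Tk 0); apply: ereal_sup_ubound; exists 0 => /=.
    by rewrite rnorm0.
  by rewrite linear0 rnorm0.
exists (fine sup_opnorm); first exact: fine_ge0.
move=> x k; rewrite rnorm_transport; apply: opnorm_bound.
by rewrite fineK// ge0_fin_numE.
Qed.

Lemma lp_dom_shift (p : R) x : 1 <= p -> lp_dom p x -> lp_dom p (shift_seq x).
Proof.
move=> p1 xp; have [C C0 CT] := shift_bound.
have reidx : lp_sum p x = \esum_(k in [set: int]) (rnorm (x (k + 1)) `^ p)%:E.
  apply: reindex_esum; split => //.
  - by move=> k l _ _; exact: addIr.
  - by move=> k _; exists (k - 1) => //; rewrite subrK.
rewrite /lp_dom/=.
apply: (@le_lt_trans _ _ ((C `^ p)%:E * lp_sum p x)%E); last first.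
  by rewrite lp_sumE// -EFinM ltry.
rewrite reidx.
apply: le_trans (esum_scale (powR_ge0 _ _) _) => [|k]; last exact: powR_ge0.
apply: le_esum => k _; rewrite lee_fin -powRM ?rnorm_ge0//.
by apply: ge0_ler_powR; rewrite ?nnegrE ?mulr_ge0 ?rnorm_ge0// (le_trans ler01).
Qed.

Lemma c0_dom_shift x : c0_dom x -> c0_dom (shift_seq x).
Proof.
move=> x0 e e0; have [C C0 CT] := shift_bound.
have C1 : 0 < C + 1 by rewrite ltr_wpDl.
have [N xN] := x0 _ (divr_gt0 e0 C1); exists N.+1 => k Nk.
have /xN : (N <= `|(k + 1)%R|)%N.
  by move: Nk; case: k => [k|[|k]] //=; rewrite ?addn1; lia.
rewrite ltr_pdivlMr// => h; apply: le_lt_trans (CT _ _) _.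
apply: le_lt_trans h; rewrite mulrC; apply: ler_wpM2l; first exact: rnorm_ge0.
by rewrite lerDl.
Qed.

Definition lp_shift (p : R) (p1 : 1 <= p) (x : seq_carrier (lp_space X p1)) :
    seq_carrier (lp_space X p1) :=
  @SeqElt _ _ _ (lp_space X p1) _ (lp_dom_shift p1 (seq_valP x)).

Definition c0_shift (x : seq_carrier (c0_space X)) :
    seq_carrier (c0_space X) :=
  @SeqElt _ _ _ (c0_space X) _ (c0_dom_shift (seq_valP x)).

End shift.

Section composition.
Variables (R : realType) (s : scalars).
Local Notation K := (scalar_field R s).
Variable X : int -> normedModType K.
Variable T : forall k, {linear X k -> X (k - 1)}.

Lemma comp_index0 (k n : int) : n = k + 0%N%:Z -> n = k.
Proof. by rewrite addr0. Qed.

Lemma comp_indexS (k n : int) (m : nat) :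
  n = k + m.+1%:Z -> n - 1 = k + m%:Z.
Proof. by move=> ->; rewrite intS; ring. Qed.

Fixpoint comp_steps (k : int) (m : nat) : forall n, n = k + m%:Z -> X n -> X k :=
  match m with
  | 0%N => fun n e x => transport X (comp_index0 e) x
  | m'.+1 => fun n e x => comp_steps (comp_indexS e) (T n x)
  end.

Lemma comp_index (k n : int) : k <= n -> n = k + `|n - k|%N%:Z.
Proof. by move=> kn; rewrite gez0_abs ?subr_ge0//; ring. Qed.

(* T_{k+1} o ... o T_n, and the identity if k = n *)
Definition comp_T (k n : int) (kn : k <= n) : X n -> X k :=
  comp_steps (comp_index kn).

End composition.

Lemma subz_le (j : int) (n : nat) : j - n%:Z <= j.
Proof. by rewrite gerBl. Qed.

Lemma addz_ge (j : int) (n : nat) : j <= j + n%:Z.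
Proof. by rewrite lerDl. Qed.

Definition mixing (Y : topologicalType) (S : Y -> Y) : Prop :=
  forall U V : set Y, open U -> open V -> U !=set0 -> V !=set0 ->
    finite_set (~` [set n : nat | (iter n S @` U) `&` V !=set0]).

(* Main.v *)
(* For an additive operator S the lower limit of the graphs of the iterates S^n
   is a closed subgroup of Y x Y, and S is mixing as soon as it is all of Y x Y.
   For the shift, condition (2), applied to balls of radius 1 around multiples
   of a vector and rescaled, puts (a e_j, 0) and (0, b e_j) into this subgroup
   for all j, a and b: approximate a by vectors whose n-step images tend to 0,
   and b by n-step images of vectors that tend to 0. Density of the finitely
   supported sequences then gives all of Y x Y. Conversely (2) is read off from
   mixing by means of the coordinate projections. *)
Require Import Defs.
From mathcomp Require Import all_boot all_order all_algebra.
From mathcomp Require Import all_classical all_reals all_analysis.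

Set Implicit Arguments.
Unset Strict Implicit.
Unset Printing Implicit Defensive.

Import Order.TTheory GRing.Theory Num.Theory.
Import numFieldNormedType.Exports.

Local Open Scope classical_set_scope.
Local Open Scope ring_scope.

(** * Balls and open sets through the real-valued norm *)

Section scalar_norm.
Variables (R : realType) (s : scalars).
Local Notation K := (scalar_field R s).
Implicit Types V : normedModType K.

Lemma lt_of_real (a b : R) : ((of_real a : K) < of_real b) = (a < b).
Proof. by rewrite !lt_neqAle le_of_real (inj_eq (@of_real_inj R s)). Qed.

Lemma rnormN V (x : V) : rnorm (- x) = rnorm x.
Proof. by rewrite /rnorm normrN. Qed.

Lemma ball_rnormE V (x : V) (e : R) :
  ball x (of_real e) = [set y | rnorm (x - y) < e].
Proof.
rewrite -ball_normE; apply/seteqP.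
by split=> y /=; rewrite -of_real_rnorm lt_of_real.
Qed.

Lemma ball1_rnormE V (x : V) : ball x 1 = [set y | rnorm (x - y) < 1].
Proof. by rewrite -ball_rnormE; case: s V x. Qed.

Lemma open_rnormP V (U : set V) :
  open U <-> forall x, U x -> exists2 e : R, 0 < e &
                 forall y, rnorm (x - y) < e -> U y.
Proof.
rewrite openE; split=> [Uo x /Uo/nbhs_ballP[e /= e0 eU]|Uo x /Uo[e e0 eU]].
  (* A positive element of [K] is real, so the radius comes from [R]. *)
  have eE := real_partK (ltW e0); exists (real_part e).
    by rewrite -lt_of_real eE of_real0.
  by move=> y xy; apply: eU; rewrite -eE ball_rnormE.
apply/nbhs_ballP; exists (of_real e); first by rewrite /= -of_real0 lt_of_real.
by rewrite ball_rnormE.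
Qed.

End scalar_norm.

Lemma finite_setC_natP (A : set nat) :
  finite_set (~` A) <-> exists n0 : nat, forall n, (n0 <= n)%N -> A n.
Proof.
split=> [Af|[n0 nA]].
  move/finite_seqP: Af => [r rA]; exists (\max_(i <- r) i).+1 => n rn.
  apply: contrapT => nA; have /= : [set` r] n by rewrite -rA.
  by move=> /(@leq_bigmax_seq _ _ xpredT id)/(_ isT); rewrite leqNgt rn.
apply: sub_finite_set (finite_II n0) => n /= nA'.
by rewrite ltnNge; apply/negP => /nA.
Qed.

(** Condition (2) only offers balls of radius 1 in the small slots; dilation by [e] turns them into
    balls of radius [e]. *)
Lemma ball1_scaled (R : realType) (s : scalars)
    (V : normedModType (scalar_field R s)) (e : R) (x y : V) : 0 < e ->
  ball ((of_real e)^-1 *: x) 1 y <-> rnorm (x - of_real e *: y) < e.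
Proof.
move=> e0; have ek : (of_real e : scalar_field R s) != 0.
  by rewrite -(@of_real0 R s) (inj_eq (@of_real_inj R s)) gt_eqF.
have -> : x - of_real e *: y = of_real e *: ((of_real e)^-1 *: x - y).
  by rewrite scalerBr scalerA divff// scale1r.
by rewrite ball1_rnormE /= rnormZ norm_of_real ?ltW// gtr_pMr.
Qed.

Lemma ball01_scaled (R : realType) (s : scalars)
    (V : normedModType (scalar_field R s)) (e : R) (y : V) : 0 < e ->
  ball 0 1 y <-> rnorm (of_real e *: y) < e.
Proof.
by move=> /(ball1_scaled 0 y); rewrite scaler0 sub0r rnormN.
Qed.

(** * The lower limit of the graphs of the iterates *)

Section follows.
Variables (R : realType) (s : scalars).
Variable Y : normedModType (scalar_field R s).
Variable S : Y -> Y.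

(* (a, b) lies in the lower limit of the graphs of the iterates S^n. *)
Definition follows (a b : Y) : Prop :=
  forall e : R, 0 < e -> exists n0 : nat, forall n, (n0 <= n)%N ->
    exists u, rnorm (a - u) < e /\ rnorm (b - iter n S u) < e.

Lemma mixing_follows : (forall a b, follows a b) -> mixing S.
Proof.
move=> ab U V /open_rnormP Uo /open_rnormP Vo [a Ua] [b Vb].
have [d d0 dU] := Uo a Ua; have [e e0 eV] := Vo b Vb.
have de0 : 0 < Num.min d e by rewrite lt_min d0.
apply/finite_setC_natP; have [n0 n0P] := ab a b _ de0; exists n0 => n /n0P.
move=> [u []]; rewrite !lt_min => /andP[ud _] /andP[_ ue].
by exists (iter n S u); split; [exists u => //; exact: dU|exact: eV].
Qed.

Hypothesis SD : {morph S : x y / x + y}.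

Lemma iterD n : {morph iter n S : x y / x + y}.
Proof. by move=> x y; elim: n => //= n ->; rewrite SD. Qed.

(** Each approximation is available for all large n, hence both at a common n, where the
    approximating vectors can be added. *)
Lemma followsD a b a' b' :
  follows a b -> follows a' b' -> follows (a + a') (b + b').
Proof.
move=> ab ab' e e0; have e2 : 0 < e / 2 by rewrite divr_gt0.
have [n0 n0P] := ab _ e2; have [n1 n1P] := ab' _ e2.
exists (maxn n0 n1) => n; rewrite geq_max => /andP[/n0P[u [au bu]]].
move=> /n1P[v [av bv]]; exists (u + v); rewrite iterD [e]splitr.
by split; rewrite opprD addrACA; apply: le_lt_trans (rnormD _ _) _;
  rewrite ltrD.
Qed.

Lemma follows0 : follows 0 0.
Proof.
move=> e e0; exists 0%N => n _; exists 0; suff -> : iter n S 0 = 0.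
  by rewrite subrr rnorm0.
(* By additivity S^n 0 is its own double. *)
by apply: (@addrI _ (iter n S 0)); rewrite -iterD !addr0.
Qed.

Lemma follows_closed a b :
  (forall e : R, 0 < e -> exists a' b',
     [/\ rnorm (a - a') < e, rnorm (b - b') < e & follows a' b']) ->
  follows a b.
Proof.
move=> ab e e0; have e2 : 0 < e / 2 by rewrite divr_gt0.
have [a' [b' [aa' bb' /(_ _ e2)[n0 n0P]]]] := ab _ e2.
exists n0 => n /n0P[u [a'u b'u]]; exists u.
rewrite [e]splitr.
by split; [rewrite -(subrKA a')|rewrite -(subrKA b')];
  apply: le_lt_trans (rnormD _ _) _; rewrite ltrD.
Qed.

End follows.

(** * Finitely supported sequences in l^p and c_0 *)

Section delta.
Variables (R : realType) (s : scalars).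
Variable X : int -> normedModType (scalar_field R s).

(** The sequence a e_j. Its entry at k must have type [X k], so [a] is transported along a proof of
    j = k. *)
Definition delta (j : int) (a : X j) (k : int) : X k :=
  match j =P k with ReflectT e => transport X e a | ReflectF _ => 0 end.

Lemma delta_id j (a : X j) : delta a j = a.
Proof.
by rewrite /delta; case: eqP => // e; rewrite (eq_irrelevance e erefl).
Qed.

Lemma delta_neq j (a : X j) k : j != k -> delta a k = 0.
Proof. by rewrite /delta; case: eqP. Qed.

Lemma rnorm_delta j (a : X j) k :
  rnorm (delta a k) = if j == k then rnorm a else 0.
Proof.
have [<-|jk] := eqVneq; first by rewrite delta_id.
by rewrite delta_neq// rnorm0.
Qed.

(* c_00 is dense in E, and the coordinate maps and the embeddings X_j -> E are
   contractions; this is all that the argument uses of l^p and c_0. *)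
Record regular (E : seq_space X) : Prop := Regular {
  coord_le : forall x k, seq_dom E x -> rnorm (x k) <= seq_norm E x ;
  delta_dom : forall j (a : X j), seq_dom E (delta a) ;
  delta_le : forall j (a : X j), seq_norm E (delta a) <= rnorm a ;
  tail_small : forall x, seq_dom E x -> forall e : R, 0 < e ->
    exists2 r : seq int, uniq r &
      let tail := fun k => if k \in r then 0 else x k in
      seq_dom E tail /\ seq_norm E tail < e
}.

Lemma c0_regular : regular (c0_space X).
Proof.
split=> /=.
- by move=> x k; exact: c0_norm_ub.
- move=> j a e e0; exists `|j|.+1 => k jk; rewrite rnorm_delta.
  by case: eqP => // kj; rewrite kj ltnn in jk.
- move=> j a; apply: c0_norm_le => k; rewrite rnorm_delta.
  by case: ifP => // _; exact: rnorm_ge0.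
- move=> x x0 e e0.
  (* Strict bounds on the entries only give a weak bound on the supremum, hence e / 2. *)
  have [N xN] := x0 _ (divr_gt0 e0 (ltr0Sn R 1)).
  (* The indices of absolute value below N; 0 is listed twice, whence [undup]. *)
  pose r := [seq i%:Z | i <- iota 0 N] ++ [seq - i%:Z | i <- iota 0 N].
  have rN (k : int) : k \notin undup r -> (N <= `|k|)%N.
    rewrite mem_undup mem_cat negb_or leqNgt => /andP[/negP kr /negP kr'].
    apply/negP => kN; have [k0|k0] := leP 0 k.
      by apply: kr; apply/mapP; exists `|k|%N; rewrite ?mem_iota// gez0_abs.
    apply: kr'; apply/mapP; exists `|k|%N; rewrite ?mem_iota// ltz0_abs//.
    by rewrite opprK.
  exists (undup r); rewrite ?undup_uniq//; split.
    move=> d /x0[M xM]; exists M => k /xM xk; case: ifP => // _.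
    by rewrite rnorm0 (le_lt_trans (rnorm_ge0 _) xk).
  apply: (@le_lt_trans _ _ (e / 2)).
    apply: c0_norm_le => k; case: ifPn => [_|/rN/xN/ltW//].
    by rewrite rnorm0 divr_ge0// ltW.
  by rewrite ltr_pdivrMr// ltr_pMr// ltr1n.
Qed.

Lemma lp_regular (p : R) (p1 : 1 <= p) : regular (lp_space X p1).
Proof.
have p0 : 0 < p by exact: lt_le_trans p1.
have deltaE j (a : X j) : lp_sum p (delta a) = (rnorm a `^ p)%:E.
  rewrite /lp_sum [RHS](_ : _ = \esum_(k in [set j]) (rnorm a `^ p)%:E).
    rewrite [RHS]esum_mkcond; apply: eq_esum => k _.
    rewrite in_set1 rnorm_delta; case: (eqVneq k j) => //= _.
    by rewrite powR0// gt_eqF.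
  by rewrite esum_set1// lee_fin powR_ge0.
have delta_dom j (a : X j) : lp_dom p (delta a).
  by rewrite /lp_dom/= deltaE ltry.
split=> //=.
- move=> x k xp; apply: (powR_le2 p1); rewrite ?rnorm_ge0 ?lp_norm_ge0//.
  rewrite -lee_fin -lp_sumE//; apply: esum_ge.
  by exists [set k]; [split=> //; exact: finite_set1|rewrite fsbig_set1].
- move=> j a; apply: (powR_le2 p1); rewrite ?rnorm_ge0 ?lp_norm_ge0//.
  by rewrite -lee_fin -lp_sumE// deltaE.
- move=> x xp e e0; have ep0 : 0 < e `^ p by exact: powR_gt0.
  have xfin := lp_sum_fin xp.
  (* Some finite partial sum comes within e^p of the total; its index set is the one to remove. *)
  have [_ [F [Ffin _] <-] xF] : exists2 y,
      [set (\sum_(k \in F) (rnorm (x k) `^ p)%:E)%E | F in fsets [set: int]] y &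
      (lp_sum p x - (e `^ p)%:E < y)%E.
    by apply: ereal_sup_gt; rewrite lteBlDr// lteDl// lte_fin.
  have [r rF] := (finite_seqP _).1 Ffin.
  exists (undup r); rewrite ?undup_uniq//.
  set tail := fun k => _.
  have tailE : lp_sum p x =
      ((\sum_(k \in F) (rnorm (x k) `^ p)%:E)%R + lp_sum p tail)%E.
    rewrite {1}/lp_sum (esumID F) ?setTI; last first.
      by move=> k _; rewrite lee_fin powR_ge0.
    congr (_ + _)%E.
      by rewrite esum_fset// => k _; rewrite lee_fin powR_ge0.
    rewrite esum_mkcond; apply: eq_esum => k _.
    rewrite /tail mem_undup classical_sets.in_setC rF mem_setE.
    by case: (k \in r); rewrite //= rnorm0 powR0// gt_eqF.
  (* The sum over F is finite, so it cancels from both sides. *)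
  have tail_lt : (lp_sum p tail < (e `^ p)%:E)%E.
    move: xF; rewrite lteBlDr// tailE lteD2lE//.
    by move: xfin; rewrite tailE fin_numD => /andP[].
  have tailp : lp_dom p tail by rewrite /lp_dom/= (lt_trans tail_lt)// ltry.
  split=> //; rewrite ltNge; apply/negP => /(ge0_ler_powR (ltW p0)).
  rewrite !nnegrE (ltW e0) lp_norm_ge0 => /(_ isT isT).
  by rewrite -lee_fin -lp_sumE// leNgt tail_lt.
Qed.

End delta.

(** * Powers of the shift and the two implications *)

Section shift_powers.
Variables (R : realType) (s : scalars).
Variable X : int -> normedModType (scalar_field R s).
Variable T : forall k, {linear X k -> X (k - 1)}.

Lemma transportD k l (e : k = l) (a b : X k) :
  transport X e (a + b) = transport X e a + transport X e b.
Proof. by case: l / e. Qed.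

Lemma transportZ k l (e : k = l) (c : scalar_field R s) (a : X k) :
  transport X e (c *: a) = c *: transport X e a.
Proof. by case: l / e. Qed.

Lemma transport_coord k l (e : k = l) (x : forall i, X i) :
  transport X e (x k) = x l.
Proof. by case: l / e. Qed.

(** Freeing the source index from the form k + 1 lets the iteration follow the indices of
    [comp_steps]. *)
Lemma shift_seqE x l k (e : l - 1 = k) :
  shift_seq T x k = transport X e (T l (x l)).
Proof.
suff tr l' (ll' : l' = l) (e' : l' - 1 = k) :
    transport X e' (T l' (x l')) = transport X e (T l (x l)).
  by apply: tr; rewrite -e subrK.
by case: l / ll' e => e; rewrite (eq_irrelevance e e').
Qed.

Lemma shift_seqD x y k :
  shift_seq T (fun i => x i + y i) k = shift_seq T x k + shift_seq T y k.
Proof. by rewrite /shift_seq linearD transportD. Qed.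

Lemma iter_shift_seq m x k l (e : l = k + m%:Z) :
  iter m (shift_seq T) x k = comp_steps T e (x l).
Proof.
elim: m x l e => [|m IH] x l e; first by rewrite /= transport_coord.
(* Peeling off the first application matches [comp_steps], where T_l acts first. *)
by rewrite iterSr (IH _ _ (comp_indexS e)) (@shift_seqE _ l _ erefl).
Qed.

Lemma comp_stepsZ (c : scalar_field R s) m k l (e : l = k + m%:Z) a :
  comp_steps T e (c *: a) = c *: comp_steps T e a.
Proof.
by elim: m l e a => [|m IH] l e a /=; rewrite ?linearZ ?IH// transportZ.
Qed.

Lemma comp_TZ (c : scalar_field R s) k l (kl : k <= l) a :
  comp_T T kl (c *: a) = c *: comp_T T kl a.
Proof. exact: comp_stepsZ. Qed.

Lemma comp_T0 k l (kl : k <= l) : comp_T T kl 0 = 0.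
Proof. by rewrite -(scale0r 0) comp_TZ scale0r. Qed.

Lemma iter_shift_seq_comp m x k l (kl : k <= l) : l = k + m%:Z ->
  iter m (shift_seq T) x k = comp_T T kl (x l).
Proof.
move=> e; rewrite /comp_T; have mE : `|l - k|%N = m by rewrite e addrC addKr.
by move: (comp_index kl); rewrite mE => e'; exact: iter_shift_seq.
Qed.

(** Assertion (2), named so that l^p and c_0 share one proof. *)
Definition orbit_condition : Prop :=
  forall (j : int) (U V : set (X j)),
    open U -> open V -> U !=set0 -> V !=set0 ->
    exists n0 : nat, forall n : nat, (n0 <= n)%N ->
      (comp_T T (subz_le j n) @` U) `&` ball (0 : X (j - n%:Z)) 1 !=set0 /\
      (comp_T T (addz_ge j n) @` ball (0 : X (j + n%:Z)) 1) `&` V !=set0.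

Variable E : seq_space X.
Hypothesis E_regular : regular E.
Local Notation Y := (seq_carrier E).

Lemma seq_rnormE (x : Y) : rnorm x = seq_norm E x.
Proof. exact: of_realK. Qed.

Lemma seq_subE (x y : Y) k : (x - y) k = x k - y k.
Proof. by rewrite -[- y k]scaleN1r. Qed.

Lemma rnorm_coord_le (x : Y) k : rnorm (x k) <= rnorm x.
Proof. by rewrite seq_rnormE; apply: (coord_le E_regular); exact: seq_valP. Qed.

Definition embed j (a : X j) : Y := SeqElt (delta_dom E_regular a).

Lemma embedB j (a b : X j) : embed (a - b) = embed a - embed b.
Proof.
apply: seq_eqP => k; rewrite seq_subE /= /delta.
by case: eqP => [e|_]; [case: k / e|rewrite subr0].
Qed.

Lemma rnorm_embed_le j (a : X j) : rnorm (embed a) <= rnorm a.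
Proof. by rewrite seq_rnormE; exact: delta_le. Qed.

Lemma sum_embedE (x : Y) (r : seq int) k : uniq r ->
  (\sum_(j <- r) embed (x j)) k = if k \in r then x k else 0.
Proof.
elim: r => [|j r IH] /=; first by rewrite big_nil.
move=> /andP[jr /IH rE]; rewrite big_cons inE.
rewrite [LHS](_ : _ = delta (x j) k + (\sum_(j <- r) embed (x j)) k)// rE.
have [->|kj] := eqVneq k j; first by rewrite (negbTE jr) delta_id addr0.
by rewrite delta_neq ?add0r// eq_sym.
Qed.

(** Density of c_00 as an induction principle: cutting off a small tail leaves a finite sum of
    embedded vectors. *)
Lemma embed_ind (Q : Y -> Prop) : Q 0 ->
  (forall x y, Q x -> Q y -> Q (x + y)) ->
  (forall x, (forall e : R, 0 < e -> exists2 y, rnorm (x - y) < e & Q y) ->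
    Q x) ->
  (forall j (a : X j), Q (embed a)) -> forall x, Q x.
Proof.
move=> Q0 QD Qcl Qembed x; apply: Qcl => e e0.
have [r ru [taildom tail_lt]] := tail_small E_regular (seq_valP x) e0.
exists (\sum_(j <- r) embed (x j)); last by apply: big_ind => // j _.
rewrite (_ : x - _ = SeqElt taildom) ?seq_rnormE//.
apply: seq_eqP => k; rewrite seq_subE sum_embedE//=.
by case: ifP => _; rewrite (subrr, subr0).
Qed.

Variable S : Y -> Y.
Hypothesis S_shift : forall x, seq_val (S x) = shift_seq T x.

Lemma shift_op_additive : {morph S : x y / x + y}.
Proof.
by move=> x y; apply: seq_eqP => k; rewrite S_shift shift_seqD /= !S_shift.
Qed.

Lemma iter_shift_opE n (x : Y) k l (kl : k <= l) : l = k + n%:Z ->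
  iter n S x k = comp_T T kl (x l).
Proof.
move=> /(iter_shift_seq_comp x kl) <-; congr (_ k).
by elim: n => //= n IH; rewrite S_shift IH.
Qed.

Lemma iter_shift_op_embed n k l (kl : k <= l) (a : X l) : l = k + n%:Z ->
  iter n S (embed a) = embed (comp_T T kl a).
Proof.
move=> e; apply: seq_eqP => i; have [<-|ki] := eqVneq k i.
  by rewrite (iter_shift_opE _ kl e) /= !delta_id.
(* Coordinate i of the image reads the entry at i + n, which is not l since i is not k. *)
rewrite (iter_shift_opE _ (addz_ge i n) erefl) /= !delta_neq ?comp_T0//.
by rewrite e (inj_eq (addIr _)).
Qed.

Lemma open_coord j (U : set (X j)) : open U -> open [set x : Y | U (x j)].
Proof.
move=> /open_rnormP Uo; apply/open_rnormP => x /Uo[e e0 eU].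
exists e => // y xy; apply: eU; apply: le_lt_trans xy.
by rewrite -seq_subE rnorm_coord_le.
Qed.

(** Mixing is applied to the cylinders over [U] and [V] at coordinate j, each paired with the unit
    ball [W], whose elements have all coordinates in the unit balls. *)
Lemma mixing_orbit_condition : mixing S -> orbit_condition.
Proof.
move=> mixS j U V Uo Vo [a Ua] [b Vb].
pose W : set Y := ball 0 1.
have Wo : open W by exact: ball_open.
have W0 : W !=set0 by exists 0; exact: ballxx.
have coordW x k : W x -> ball (0 : X k) 1 (x k).
  rewrite /W !ball1_rnormE /= !sub0r !rnormN.
  by apply: le_lt_trans; exact: rnorm_coord_le.
have U0 : [set x : Y | U (x j)] !=set0 by exists (embed a); rewrite /= delta_id.
have V0 : [set x : Y | V (x j)] !=set0 by exists (embed b); rewrite /= delta_id.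
have /finite_setC_natP[n0 n0P] := mixS _ _ (open_coord Uo) Wo U0 W0.
have /finite_setC_natP[n1 n1P] := mixS _ _ Wo (open_coord Vo) W0 V0.
exists (maxn n0 n1) => n; rewrite geq_max => /andP[/n0P[_ [[x Ux <-] Wx]]].
move=> /n1P[_ [[y Wy <-] Vy]]; split.
  exists (comp_T T (subz_le j n) (x j)); split; first by exists (x j).
  by rewrite -(iter_shift_opE (n := n)) ?subrK//; exact: coordW.
exists (comp_T T (addz_ge j n) (y (j + n%:Z))); split.
  by exists (y (j + n%:Z)) => //; exact: coordW.
by rewrite -(iter_shift_opE (n := n)).
Qed.

Lemma orbit_condition_mixing : orbit_condition -> mixing S.
Proof.
move=> cond; apply: mixing_follows => a b.
have SD := shift_op_additive.
have ball_near j (w : X j) : open (ball w 1) /\ ball w 1 !=set0.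
  by split; [exact: ball_open|exists w; exact: ballxx].
(* Split (a, b) as (a, 0) + (0, b). *)
rewrite -[a]addr0 -[b]add0r; apply: followsD => //.
  apply: (@embed_ind (follows S ^~ 0)) => [|x y Qx Qy|x Qx|j c e e0].
  - exact: follows0.
  - by rewrite -[0]addr0; exact: followsD.
  - apply: follows_closed => // e e0; have [y xy Qy] := Qx e e0.
    by exists y, 0; rewrite subrr rnorm0.
  (* Dilating the unit ball around c / e by e gives the ball of radius e around c. *)
  have [Bo B0] := ball_near j ((of_real e)^-1 *: c).
  have [n0 n0P] := cond j _ _ Bo Bo B0 B0; exists n0 => n /n0P[].
  move=> [_ [[v /(ball1_scaled _ _ e0) cv <-] Tv] _].
  have vn : j = j - n%:Z + n%:Z by rewrite subrK.
  (* This vector is within e of c e_j, and its n-th image, at coordinate j - n, has norm below e. *)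
  exists (embed (of_real e *: v)).
  rewrite -embedB (iter_shift_op_embed (subz_le j n) _ vn) comp_TZ.
  split; first exact: le_lt_trans (rnorm_embed_le _) cv.
  move/(ball01_scaled _ e0): Tv; rewrite sub0r rnormN.
  exact/le_lt_trans/rnorm_embed_le.
apply: (@embed_ind (follows S 0)) => [|x y Qx Qy|x Qx|j c e e0].
- exact: follows0.
- by rewrite -[0]addr0; exact: followsD.
- apply: follows_closed => // e e0; have [y xy Qy] := Qx e e0.
  by exists 0, y; rewrite subrr rnorm0.
have [Bo B0] := ball_near j ((of_real e)^-1 *: c).
have [n0 n0P] := cond j _ _ Bo Bo B0 B0; exists n0 => n /n0P[] _.
move=> [_ [[v Tv <-] /(ball1_scaled _ _ e0) cv]].
(* Now the vector sits at coordinate j + n with norm below e, and n steps bring it within e of c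
   e_j. *)
exists (embed (of_real e *: v)).
rewrite (iter_shift_op_embed (addz_ge j n) _ erefl) comp_TZ -embedB.
split; last exact: le_lt_trans (rnorm_embed_le _) cv.
move/(ball01_scaled _ e0): Tv; rewrite sub0r rnormN.
exact/le_lt_trans/rnorm_embed_le.
Qed.

End shift_powers.

Theorem proposition3p1 (R : realType) (s : scalars)
    (X : int -> completeNormedModType (scalar_field R s))
    (T : forall k : int, {linear X k -> X (k - 1)})
    (T_cont : forall k : int, continuous (T k))
    (T_bounded : (sup_opnorm T < +oo)%E) :
  let condition2 :=
    forall (j : int) (U V : set (X j)),
      open U -> open V -> U !=set0 -> V !=set0 ->
      exists n0 : nat, forall n : nat, (n0 <= n)%N ->
        (comp_T T (subz_le j n) @` U) `&` ball (0 : X (j - n%:Z)) 1 !=set0 /\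
        (comp_T T (addz_ge j n) @` ball (0 : X (j + n%:Z)) 1) `&` V !=set0 in
  (forall (p : R) (p1 : 1 <= p),
     mixing (@lp_shift R s X T T_bounded p p1) <-> condition2) /\
  (mixing (@c0_shift R s X T T_bounded) <-> condition2).
Proof.
(* [condition2] is [orbit_condition T] by conversion, so both equivalences are instances of the
   result for regular spaces. *)
move=> condition2; split=> [p p1|].
  have S_shift (x : seq_carrier (lp_space X p1)) :
    seq_val (lp_shift T_bounded x) = shift_seq T x by [].
  split; first exact: (mixing_orbit_condition (lp_regular _ p1) S_shift).
  exact: (orbit_condition_mixing (lp_regular _ p1) S_shift).
have S_shift (x : seq_carrier (c0_space X)) :
  seq_val (c0_shift T_bounded x) = shift_seq T x by [].
split; first exact: (mixing_orbit_condition (c0_regular _) S_shift).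
exact: (orbit_condition_mixing (c0_regular _) S_shift).
Qed.
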